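(* Let $\varphi\colon\mathbb{D}\to\mathbb{A}$ be a bijective conformal map from the open unit disk $\mathbb{D}$ onto a simply connected domain $\mathbb{A}\subset\mathbb{C}$ of the form $\varphi(z)=p(z)/q(z)$, where $p(z)=\sum_{j=0}^{n_p}\alpha_jz^j$ and $q(z)=\sum_{i=0}^{n_q}\beta_iz^i$ are polynomials with complex coefficients of order $n_p\ge1$ and $n_q\ge1$, respectively. Let $G(\cdot)=\mathbf{c}^*(\cdot\,\mathbf{I}-\mathbf{A})^{-1}\mathbf{b}\in\mathcal{H}_2(\mathbb{A})$ be the transfer function of a linear time-invariant system, with $\mathbf{A}\in\mathbb{C}^{n\times n}$ and $\mathbf{b},\mathbf{c}\in\mathbb{C}^n$. Let $$G_r(\cdot)=\mathbf{c}_r^*\left(\varphi^{-1}(\cdot)\mathbf{E}_r-\mathbf{A}_r\right)^{-1}\mathbf{b}_r+d_r\in\mathcal{H}_2(\mathbb{A}),$$ where $\mathbf{E}_r,\mathbf{A}_r\in\mathbb{C}^{r\times r}$, $\mathbf{b}_r,\mathbf{c}_r\in\mathbb{C}^r$, $d_r\in\mathbb{C}$, and the eigenvalues $\lambda_j$ of the pencil $\mathbf{A}_r\mathbf{x}=\lambda\mathbf{E}_r\mathbf{x}$ satisfy $|\lambda_j|>1$. For an input sequence $u=(u_k)\in\ell_2$, let $y=(y_k)$ be the output of the discrete-time delay system with transfer function $G\circ\varphi(z^{-1})$, $$\sum_{j=0}^{n_p}\alpha_jx_{k-j}-\sum_{i=0}^{n_q}\beta_i\mathbf{A}x_{k-i}=\mathbf{b}\sum_{i=0}^{n_q}\beta_iu_{k-i},\qquad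 y_k=\mathbf{c}^*x_k,\qquad k\in\mathbb{N},$$ with initial conditions $x_\ell=0$ for $\ell=-\max(n_p,n_q),\dots,0$, and let $\widehat y=(\widehat y_k)$ be the output of the system with transfer function $G_r\circ\varphi(z^{-1})$, $$\mathbf{A}_r\widehat x_k=\mathbf{E}_r\widehat x_{k-1}-\mathbf{b}_ru_k,\qquad \widehat y_k=\mathbf{c}_r^*\widehat x_k+d_ru_k,$$ with $\widehat x_\ell=0$ for $\ell\in\{-1,0\}$. Then $$\|y-\widehat y\|_{\ell_\infty}=\max_{k>0}|y_k-\widehat y_k|\le\|G-G_r\|_{\mathcal{H}_2(\mathbb{A})}\,\|u\|_{\ell_2}.$$
   Context: A conformal map is an analytic map with nowhere vanishing derivative. $\mathcal{H}_2$ is the Hardy space of analytic $F\colon\mathbb{D}\to\mathbb{C}$ with $\sup_{0<\rho<1}\frac1{2\pi}\int_0^{2\pi}|F(\rho e^{\mathrm{i}\theta})|^2\,\mathrm{d}\theta<\infty$, with norm $\|F\|_{\mathcal{H}_2}=\left(\frac1{2\pi}\int_0^{2\pi}|F(e^{\mathrm{i}\theta})|^2\,\mathrm{d}\theta\right)^{1/2}$ (boundary values). The space $\mathcal{H}_2(\mathbb{A})$ consists of the analytic $G\colon\mathbb{A}\to\mathbb{C}$ with $G\circ\varphi\in\mathcal{H}_2$, with norm $\|G\|_{\mathcal{H}_2(\mathbb{A})}=\|G\circ\varphi\|_{\mathcal{H}_2}$. That the two systems have transfer functions $G\circ\varphi(z^{-1})$ and $G_r\circ\varphi(z^{-1})$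 means that the $\mathcal{Z}$-transforms $U,Y,\widehat Y$ of $(u_k),(y_k),(\widehat y_k)$ satisfy $Y(z)=G\circ\varphi(z^{-1})\,U(z)$ and $\widehat Y(z)=G_r\circ\varphi(z^{-1})\,U(z)$, where the $\mathcal{Z}$-transform of $(u_k)$ is $U(z)=\sum_k u_kz^{-k}$. $\|u\|_{\ell_2}=\left(\sum_k|u_k|^2\right)^{1/2}$, which by Parseval's theorem equals $\left(\frac1{2\pi}\int_0^{2\pi}|U(e^{\mathrm{i}\theta})|^2\,\mathrm{d}\theta\right)^{1/2}$; $(\cdot)^*$ is the conjugate transpose; $\mathbf{I}$ is the identity matrix. *)

(* Defs.v *)
From HB Require Import structures.
From mathcomp Require Import all_boot all_order all_algebra.
From mathcomp Require Import sesquilinear spectral.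
From mathcomp Require Import all_classical all_reals all_analysis.
From mathcomp Require Import complex.

Set Implicit Arguments.
Unset Strict Implicit.
Unset Printing Implicit Defensive.
Import Order.TTheory GRing.Theory Num.Theory.
Import numFieldNormedType.Exports.
Import ComplexField.Normc.

#[global] Open Scope classical_set_scope.
#[global] Open Scope ring_scope.
#[global] Open Scope complex_scope.
#[global] Open Scope sesquilinear_scope.

(* The regular module [(R[i])^o] is the type that carries the topology of the
   complex plane; the order on [R[i]] compares numbers with equal imaginary
   part, so that [`|z| < 1] compares (real) moduli. *)

Definition unit_disk (R : realType) : set R[i] := [set z | `|z| < 1].
Arguments unit_disk R : clear implicits.

(* On an open set: complex differentiability at each point. *)
Definition analytic_on (R : realType) (U : set R[i]) (f : R[i] -> R[i]) :=
  forall z, U z -> derivable (f : (R[i])^o -> (R[i])^o) z 1.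

Definition conformal_on (R : realType) (U : set R[i]) (f : R[i] -> R[i]) :=
  analytic_on U f /\
  forall z, U z -> 'D_1 (f : (R[i])^o -> (R[i])^o) z != 0.

Definition is_domain (R : realType) (U : set R[i]) :=
  [/\ U !=set0, open (U : set (R[i])^o) & connected (U : set (R[i])^o)].

(* Every loop [g] in [U] is null-homotopic in [U] through loops, by a homotopy
   [h] whose second argument is the homotopy parameter. *)
Definition loops_contractible (R : realType) (U : set R[i]) :=
  forall g : R -> (R[i])^o,
    {within `[0, 1], continuous g} ->
    (forall t : R, t \in `[0, 1] -> U (g t)) -> g 0 = g 1 ->
  exists h : R * R -> (R[i])^o,
    [/\ {within `[0, 1] `*` `[0, 1], continuous h},
        forall t s : R, t \in `[0, 1] -> s \in `[0, 1] -> U (h (t, s)),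
        forall t : R, t \in `[0, 1] -> h (t, 0) = g t,
        forall s : R, s \in `[0, 1] -> h (0, s) = h (1, s) &
        exists c, forall t : R, t \in `[0, 1] -> h (t, 1) = c].

Definition simply_connected_domain (R : realType) (U : set R[i]) :=
  is_domain U /\ loops_contractible U.

Definition expi (R : realType) (t : R) : R[i] := cos t +i* sin t.

Definition circle_mean (R : realType) (f : R -> R[i]) : \bar R :=
  ((2 * pi)^-1%:E *
   \int[lebesgue_measure]_(t in `[0%R, (2 * pi)%R]) (normc (f t) ^+ 2)%:E)%E.

Definition in_H2 (R : realType) (F : R[i] -> R[i]) :=
  analytic_on (unit_disk R) F /\
  (ereal_sup [set circle_mean (fun t => F (rho%:C * expi t)%R) |
              rho in [set rho : R | (0 < rho < 1)%R]] < +oo)%E.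

(* Radial boundary values, which exist for almost every [t] if [F] is in the
   Hardy space. *)
Definition boundary_value (R : realType) (F : R[i] -> R[i]) (t : R) : R[i] :=
  lim ((F (rho%:C * expi t) : (R[i])^o) @[rho --> (1 : R)^'-]).

Definition H2_norm (R : realType) (F : R[i] -> R[i]) : \bar R :=
  (circle_mean (boundary_value F) `^ 2^-1)%E.

Definition in_H2_via (R : realType) (phi : R[i] -> R[i]) (U : set R[i])
    (G : R[i] -> R[i]) :=
  analytic_on U G /\ in_H2 (G \o phi).

Definition H2_norm_via (R : realType) (phi G : R[i] -> R[i]) : \bar R :=
  H2_norm (G \o phi).

(* [c^* M^-1 b]; meaningful only for invertible [M]. *)
Definition resolvent_form (R : realType) (n : nat) (c : 'cV[R[i]]_n)
    (M : 'M[R[i]]_n) (b : 'cV[R[i]]_n) : R[i] :=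
  (c ^t* *m invmx M *m b) 0 0.

(* With no regularity assumption: for a singular pencil every [lam] is an
   eigenvalue. *)
Definition pencil_eigenvalue (R : realType) (r : nat) (A E : 'M[R[i]]_r)
    (lam : R[i]) :=
  exists2 x : 'cV[R[i]]_r, x != 0 & A *m x = lam *: (E *m x).

(* Signals are indexed by the integers so that the delayed indices [k - j] are
   literal; only their values at positive times are measured. *)
Definition l2_norm (R : realType) (u : int -> R[i]) : \bar R :=
  ((\sum_(1 <= k <oo) (normc (u k%:Z) ^+ 2)%:E) `^ 2^-1)%E.

Definition linf_norm (R : realType) (e : int -> R[i]) : \bar R :=
  ereal_sup [set (normc (e k))%:E | k in [set k : int | 0 < k]].

(* The input starts at time 1, i.e. it is extended by zero to times [k <= 0]. *)
Definition l2_input (R : realType) (u : int -> R[i]) :=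
  (forall k : int, k <= 0 -> u k = 0) /\ (l2_norm u < +oo)%E.

Definition delay_system (R : realType) (np nq n : nat) (p q : {poly R[i]})
    (A : 'M[R[i]]_n) (b c : 'cV[R[i]]_n)
    (u : int -> R[i]) (x : int -> 'cV[R[i]]_n) (y : int -> R[i]) :=
  [/\ forall l : int, - (maxn np nq)%:Z <= l <= 0 -> x l = 0,
      forall k : int, 0 < k ->
        \sum_(j < np.+1) p`_j *: x (k - j%:Z)
        - \sum_(i < nq.+1) q`_i *: (A *m x (k - i%:Z))
        = (\sum_(i < nq.+1) q`_i * u (k - i%:Z)) *: b &
      forall k : int, 0 < k -> y k = (c ^t* *m x k) 0 0].

Definition reduced_system (R : realType) (r : nat) (Er Ar : 'M[R[i]]_r)
    (br cr : 'cV[R[i]]_r) (dr : R[i])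
    (u : int -> R[i]) (x : int -> 'cV[R[i]]_r) (y : int -> R[i]) :=
  [/\ forall l : int, -1 <= l <= 0 -> x l = 0,
      forall k : int, 0 < k -> Ar *m x k = Er *m x (k - 1) - u k *: br &
      forall k : int, 0 < k -> y k = (cr ^t* *m x k) 0 0 + dr * u k].

(* Main.v *)
Require Import Defs.
From HB Require Import structures.
From mathcomp Require Import all_boot all_order all_algebra.
From mathcomp Require Import sesquilinear spectral.
From mathcomp Require Import all_classical all_reals all_analysis.
From mathcomp Require Import complex measurable_realfun.
From mathcomp Require Import zify ring lra.

Set Implicit Arguments.
Unset Strict Implicit.
Unset Printing Implicit Defensive.
Import Order.TTheory GRing.Theory Num.Theory.
Import numFieldNormedType.Exports.
Import ComplexField.Normc.

(** Both transfer functions become rational functions of [z] in the disk, and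
    the recurrences say that the generating series of the outputs are those
    rational functions times that of the input.  No convergence is needed for
    this: it is an identity of polynomials modulo every power of ['X], obtained
    from the adjugate of the polynomial pencil, and it also determines the
    output when [p(0) I - q(0) A] is singular.  Hence the error is the
    convolution of [u] with the Taylor coefficients [h] of
    [H = (G - Gr) o phi], and Cauchy-Schwarz bounds it by
    [(sum |h_j|^2)^(1/2) ||u||].

    To compare [sum |h_j|^2] with the norm of the boundary values, write [H] in
    lowest terms.  A pole at [zeta] on the circle would make the mean of
    [|G o phi|^2] over the circle of radius [rho] at least of order
    [1 / (1 - rho)], contradicting membership in the Hardy space.  So all poles
    lie outside the closed disk, [h] is summable, its partial sums converge
    uniformly to [H] on the circle, and Parseval for polynomials gives Bessel's
    inequality.  Summability of [h] also makes the error tend to [0], so that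
    the supremum is attained. *)

(** * Polynomials modulo powers of the variable *)

(** Multiplying by the adjugate solves the system up to the factor [\det M], which need not be a
    unit; this covers a pencil that is singular at 0. *)
Lemma det_scale_solution (S : comNzRingType) (m n : nat) (M : 'M[S]_n)
    (X B Z : 'M[S]_(n, m)) (a t : S) :
  M *m X = a *: B + t *: Z ->
  \det M *: X = a *: (\adj M *m B) + t *: (\adj M *m Z).
Proof.
by move=> MX; rewrite -mul_scalar_mx -mul_adj_mx -mulmxA MX mulmxDr -!scalemxAr.
Qed.

Section PolyModXn.
Variable K : fieldType.
Implicit Types P Q D N : {poly K}.

Lemma dvdp_XnP k P :
  reflect (forall i, (i < k)%N -> P`_i = 0) ('X^k %| P).
Proof.
apply: (iffP idP) => [/dvdpP[Q ->] i ik|P0]; first by rewrite coefMXn ik.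
rewrite -[P](poly_take_drop k); set T := take_poly k P.
suff -> : T = 0 by rewrite add0r dvdp_mull.
apply/polyP => i; rewrite coef_take_poly coef0.
by case: ifP => // /P0.
Qed.

(** [P] vanishes at 0 to order at most [size P], so cancelling it costs at most that many powers of
    ['X]; the cofactor [S] with [S.[0] != 0] is coprime to ['X]. *)
Lemma dvdp_Xn_cancel P Q k :
  P != 0 -> 'X^(size P + k) %| P * Q -> 'X^k %| Q.
Proof.
move=> P0; have [m [S]] := multiplicity_XsubC P 0.
rewrite P0 /= subr0 => S0 defP.
have Sn0 : S != 0 by apply: contraNneq P0 => SE; rewrite defP SE mul0r.
have sP : size P = (m + size S)%N.
  by rewrite defP size_Mmonic ?monicXn// size_polyXn addnS /= addnC.
have cXS : coprimep 'X^(size S + k) S.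
  by apply: coprimep_expl; rewrite coprimep_sym -[X in coprimep _ X]subr0 -polyC0
     coprimep_XsubC.
rewrite sP -addnA exprD {1}defP -mulrA mulrCA dvdp_mul2l ?monic_neq0 ?monicXn//.
rewrite Gauss_dvdpr//; apply: dvdp_trans.
by rewrite exprD dvdp_mull.
Qed.

Lemma poly_recr n (h : nat -> K) :
  \poly_(i < n.+1) h i = \poly_(i < n) h i + h n *: 'X^n.
Proof.
apply/polyP => i; rewrite coefD coefZ coefXn !coef_poly ltnS leq_eqVlt.
case: eqVneq => [->|_] /=; first by rewrite ltnn mulr1 add0r.
by rewrite mulr0 addr0.
Qed.

(** Division in ascending powers: each step adds the one monomial that kills the lowest remaining
    coefficient of [N - D * T]. *)
Lemma exists_quotient_series D N : D.[0] != 0 ->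
  exists h : nat -> K, forall n, 'X^n %| D * \poly_(i < n) h i - N.
Proof.
rewrite horner_coef0 => D0.
pose step T n : {poly K} := T + ((N - D * T)`_n / D`_0) *: 'X^n.
pose T := fix T n := if n is m.+1 then step (T m) m else 0 : {poly K}.
pose h n := (N - D * T n)`_n / D`_0.
have TE n : T n = \poly_(i < n) h i.
  elim: n => [|n IH]; first by rewrite poly_def big_ord0.
  by rewrite poly_recr -IH.
exists h => n; rewrite -TE; elim: n => [|n IH]; first by rewrite expr0 dvd1p.
apply/dvdp_XnP => i; rewrite ltnS /= /step mulrDr addrAC [LHS]coefD.
rewrite -mul_polyC mulrCA coefCM.
rewrite coefMXn leq_eqVlt => /orP[/eqP ->|/[dup] i_n ->]; last first.
  by move/dvdp_XnP: IH => ->//; rewrite mulr0 addr0.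
by rewrite ltnn subnn divfK// -opprB coefN addrC subrr.
Qed.

End PolyModXn.

(** * Coefficient sums and values of complex polynomials on the closed disk *)

Section NormcPoly.
Variable R : realType.
Implicit Types (P Q D N : {poly R[i]}) (z w : R[i]).

Lemma normc_ge0 z : 0 <= normc z.
Proof. exact: (normr_ge0 (z : Rcomplex R)). Qed.

Lemma ler_normc_sum I (r : seq I) (A : pred I) (F : I -> R[i]) :
  normc (\sum_(i <- r | A i) F i) <= \sum_(i <- r | A i) normc (F i).
Proof. exact: (@ler_norm_sum R (Rcomplex R) I r F A). Qed.

Lemma le_normcB z w : normc (z - w) <= normc z + normc w.
Proof. by rewrite -(normcN w) le_normcD. Qed.

Lemma le_normc_distD z w : normc z - normc w <= normc (z - w).
Proof. by rewrite lerBlDr -{1}(subrK w z) le_normcD. Qed.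

Lemma normcX z n : normc (z ^+ n) = normc z ^+ n.
Proof.
by elim: n => [|n IH]; rewrite ?expr0 ?normc1// !exprS normcM IH.
Qed.

Lemma normc_eq0 z : (normc z == 0) = (z == 0).
Proof. by apply/eqP/eqP => [/eq0_normc|->]; rewrite ?normc0. Qed.

Lemma normcE_norm z : `|z| = (normc z)%:C.
Proof. by case: z => a b; rewrite normc_def. Qed.

(** The l1 norm modulo ['X^k]. Coefficient [i] of a product involves only coefficients up to [i], so
    product estimates survive truncation and apply to power series. *)
Definition coef_norm k P : R := \sum_(i < k) normc P`_i.

Lemma coef_norm_ge0 k P : 0 <= coef_norm k P.
Proof. by apply: sumr_ge0 => i _; exact: normc_ge0. Qed.

Lemma le_coef_normD k P Q : coef_norm k (P + Q) <= coef_norm k P + coef_norm k Q.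
Proof.
by rewrite -big_split ler_sum// => i _; rewrite coefD le_normcD.
Qed.

Lemma coef_normMX k P : coef_norm k (P * 'X) <= coef_norm k P.
Proof.
rewrite /coef_norm; case: k => [|k]; first by rewrite !big_ord0.
rewrite big_ord_recl [leRHS]big_ord_recr /= coefMX eqxx normc0 add0r.
rewrite -[leLHS]addr0 lerD ?normc_ge0//.
by rewrite ler_sum// => i _; rewrite coefMX.
Qed.

(** The constant built by the induction is the l1 norm of [D]; what matters is that it does not
    depend on [k]. *)
Lemma coef_norm_mull D :
  exists2 c, 0 <= c & forall k P, coef_norm k (D * P) <= c * coef_norm k P.
Proof.
elim/poly_ind: D => [|D a [c c0 IH]].
  exists 0 => // k P; rewrite mul0r mul0r /coef_norm big1// => i _.
  by rewrite coef0 normc0.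
exists (c + normc a) => [|k P]; first by rewrite addr_ge0 ?normc_ge0.
rewrite mulrDl (le_trans (le_coef_normD _ _ _))// mulrDl lerD//.
  by rewrite mulrAC (le_trans (coef_normMX _ _)).
rewrite /coef_norm mulr_sumr ler_sum// => i _.
by rewrite coefCM normcM.
Qed.

Lemma normc_horner_le k P z : (size P <= k)%N -> normc z <= 1 ->
  normc P.[z] <= coef_norm k P.
Proof.
move=> sP z1; rewrite (horner_coef_wide _ sP).
rewrite (le_trans (ler_normc_sum _ _ _))// ler_sum// => i _.
by rewrite normcM normcX ler_piMr ?normc_ge0// exprn_ile1 ?normc_ge0.
Qed.

Lemma horner_lipschitz P :
  exists2 L, 0 <= L & forall z w, normc z <= 1 -> normc w <= 1 ->
    normc (P.[z] - P.[w]) <= L * normc (z - w).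
Proof.
elim/poly_ind: P => [|P a [L L0 IH]].
  by exists 0 => // z w _ _; rewrite !horner0 subrr normc0 mul0r.
exists (L + coef_norm (size P) P) => [|z w z1 w1].
  by rewrite addr_ge0 ?coef_norm_ge0.
rewrite !hornerMXaddC opprD addrACA subrr addr0.
have -> : P.[z] * z - P.[w] * w = (P.[z] - P.[w]) * z + P.[w] * (z - w) by ring.
rewrite (le_trans (le_normcD _ _))// !normcM mulrDl lerD//.
  rewrite (le_trans _ (IH _ _ z1 w1))// ler_piMr ?normc_ge0//.
by rewrite ler_wpM2r ?normc_ge0// normc_horner_le.
Qed.

(* The same constant serves for both estimates because both are multiplicative
   in [D]; for [D = 'X - a] it is [(normc a - 1)^-1]. *)
Lemma inverse_bounds D : D != 0 ->
    (forall z, root D z -> 1 < normc z) ->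
  exists c, [/\ 0 <= c,
    forall k P, coef_norm k P <= c * coef_norm k (D * P) &
    forall z, normc z <= 1 -> 1 <= c * normc D.[z]].
Proof.
have [s ->] := closed_field_poly_normal D.
move=> D0; have a0 : lead_coef D != 0.
  by apply: contraNneq D0 => ->; rewrite scale0r.
have {D0} Da z : root (lead_coef D *: \prod_(z <- s) ('X - z%:P)) z = (z \in s).
  by rewrite rootZ// root_prod_XsubC.
move=> rD; have {rD Da} : forall z, z \in s -> 1 < normc z.
  by move=> z zs; apply: rD; rewrite Da.
have na : 0 < normc (lead_coef D).
  by rewrite lt_neqAle normc_ge0 andbT eq_sym normc_eq0.
elim: s => [_|b s IH bs].
  exists (normc (lead_coef D))^-1%R; rewrite big_nil; split.
  - by rewrite invr_ge0 ltW.
  - move=> k P; rewrite alg_polyC /coef_norm mulr_sumr ler_sum// => i _.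
    by rewrite coefCM normcM mulKf// gt_eqF.
  - by move=> z _; rewrite alg_polyC hornerC mulVf// gt_eqF.
have [|c [c0 cP cz]] := IH; first by move=> z zs; apply: bs; rewrite inE zs orbT.
have b1 : 0 < normc b - 1 by rewrite subr_gt0 bs ?mem_head.
set E := lead_coef D *: _ in cP cz.
rewrite big_cons scalerAr -/E; exists (c * (normc b - 1)^-1)%R; split.
- by rewrite mulr_ge0// invr_ge0 ltW.
- move=> k P; rewrite -mulrA (le_trans (cP _ _))// ler_wpM2l//.
  rewrite -(ler_pM2l b1) mulVKf ?gt_eqF// mulrDl mulN1r lerBlDl -mulrA.
  (* Since [b Q = 'X Q - ('X - b) Q] and multiplication by ['X] does not increase the norm, [|b|]
     times the norm of [Q] is at most that of [Q] plus that of [('X - b) Q]. *)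
  set Q := E * P; rewrite {1}/coef_norm mulr_sumr.
  apply: (@le_trans _ _ (coef_norm k (Q * 'X) + coef_norm k (('X - b%:P) * Q))).
    rewrite -big_split ler_sum// => i _ /=.
    rewrite -normcM mulrBl coefB coefCM [_ * 'X]mulrC.
    by set u := ('X * Q)`_i; rewrite -{1}(subKr u (b * Q`_i)) le_normcB.
  by rewrite lerD ?coef_normMX.
- move=> z z1; rewrite hornerM hornerXsubC normcM.
  have zb : normc b - 1 <= normc (z - b).
    by rewrite -[leRHS]normcN opprB (le_trans _ (le_normc_distD _ _))// lerB.
  rewrite [normc (z - b) * _]mulrC mulrACA -[leLHS]mulr1.
  by rewrite ler_pM ?cz// [leRHS]mulrC ler_pdivlMr ?mul1r.
Qed.

End NormcPoly.

(** * Partial sums of real sequences *)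

Section RealSums.
Variable R : realType.

Lemma nonneg_sum_tail (a : nat -> R) (S : R) :
  (forall i, 0 <= a i) -> (forall n, \sum_(i < n) a i <= S) ->
  forall e, 0 < e -> exists n0, forall n m, (n0 <= n)%N -> (n <= m)%N ->
    \sum_(i < m) a i - \sum_(i < n) a i <= e.
Proof.
move=> a0 aS e e0; pose A := range (fun n => \sum_(i < n) a i).
have supA : has_sup A.
  by split; [exists (\sum_(i < 0) a i), 0%N | exists S => _ [n _ <-]].
have [_ [n0 _ <-] n0e] := sup_adherent e0 supA.
exists n0 => n m n0n nm.
have le_m : \sum_(i < m) a i <= sup A.
  by apply: sup_upper_bound => //; exists m.
have le_n : \sum_(i < n0) a i <= \sum_(i < n) a i.
  rewrite (big_ord_widen n (fun i => a i) n0n).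
  rewrite [leRHS](bigID (fun i : 'I_n => (i < n0)%N)) /=.
  by rewrite lerDl sumr_ge0.
lra.
Qed.

(** Lagrange's identity: the double sum of [(x i * y j - x j * y i) ^+ 2] is twice the difference of
    the two sides. *)
Lemma sum_Cauchy_Schwarz n (x y : 'I_n -> R) :
  (\sum_i x i * y i) ^+ 2 <= (\sum_i x i ^+ 2) * (\sum_i y i ^+ 2).
Proof.
have : 0 <= \sum_i \sum_j (x i * y j - x j * y i) ^+ 2.
  by apply: sumr_ge0 => i _; apply: sumr_ge0 => j _; exact: sqr_ge0.
set XY := (_ * _); set s := (\sum_i x i * y i).
suff -> : \sum_i \sum_j (x i * y j - x j * y i) ^+ 2 = XY + XY - (s ^+ 2) *+ 2.
  by rewrite mulr2n; lra.
have E i j : (x i * y j - x j * y i) ^+ 2 =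
    x i ^+ 2 * y j ^+ 2 + y i ^+ 2 * x j ^+ 2 - (x i * y i * (x j * y j)) *+ 2.
  by rewrite -mulr_natr; ring.
under eq_bigr => i _ do under eq_bigr => j _ do rewrite E.
under eq_bigr => i _ do rewrite !big_split /= sumrN sumrMnl.
rewrite !big_split /= sumrN sumrMnl -!big_distrlr /= -expr2 /XY.
by congr (_ + _ - _); rewrite mulrC.
Qed.

End RealSums.

(** * Convolution with a square-summable sequence *)

Section Convolution.
Variable R : realType.
Implicit Types (h v : nat -> R[i]).

Lemma convolution_le h v k :
  normc (\sum_(i < k.+1) h i * v (k - i)%N) ^+ 2 <=
  (\sum_(i < k.+1) normc (h i) ^+ 2) * (\sum_(i < k.+1) normc (v i) ^+ 2).
Proof.
have -> : \sum_(i < k.+1) normc (v i) ^+ 2 =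
    \sum_(i < k.+1) normc (v (k - i)%N) ^+ 2.
  rewrite (reindex_inj rev_ord_inj) /=.
  by apply: eq_bigr => i _; rewrite subSS.
apply: le_trans (sum_Cauchy_Schwarz _ _).
rewrite ler_sqr ?nnegrE ?normc_ge0//; last first.
  by apply: sumr_ge0 => i _; rewrite mulr_ge0 ?normc_ge0.
rewrite (le_trans (ler_normc_sum _ _ _))// ler_sum// => i _.
by rewrite normcM.
Qed.

(** Split the sum at a fixed [n0]: for [i < n0] the index [k - i] is large and [v] is small there;
    for [i >= n0] the tail of [h] is small and [v] is bounded. *)
Lemma convolution_to_0 h v (S V : R) :
  (forall n, \sum_(i < n) normc (h i) <= S) ->
  (forall n, \sum_(i < n) normc (v i) ^+ 2 <= V) ->
  forall e, 0 < e -> exists k0, forall k, (k0 <= k)%N ->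
    normc (\sum_(i < k.+1) h i * v (k - i)%N) <= e.
Proof.
move=> hS vV e e0.
have S0 : 0 <= S by rewrite (le_trans _ (hS 0%N))// big_ord0.
have V0 : 0 <= V by rewrite (le_trans _ (vV 0%N))// big_ord0.
have vB i : normc (v i) <= V + 1.
  have: normc (v i) ^+ 2 <= V.
    rewrite (le_trans _ (vV i.+1))// big_ord_recr /= lerDr.
    by rewrite sumr_ge0// => j _; rewrite exprn_ge0 ?normc_ge0.
  by have := normc_ge0 (v i); nra.
(* The early terms contribute at most [d * S], the tail at most [(V + 1) * d]. *)
pose d := e / (S + V + 1 + 1).
have d0 : 0 < d by rewrite divr_gt0//; lra.
have de : d * (S + V + 1) <= e.
  by rewrite /d mulrAC ler_pdivrMr; [nra|lra].
have [n0 hn0] := nonneg_sum_tail (fun i => normc_ge0 (h i)) hS d0.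
have [m0 vm0] := nonneg_sum_tail (fun i => sqr_ge0 (normc (v i))) vV
  (exprn_gt0 2 d0).
have vd i : (m0 <= i)%N -> normc (v i) <= d.
  move=> m0i; have := vm0 i i.+1 m0i (leqnSn i).
  rewrite big_ord_recr /= addrAC subrr add0r ler_sqr ?nnegrE ?normc_ge0//.
  exact: ltW.
exists (n0 + m0)%N => k kge; rewrite (le_trans (ler_normc_sum _ _ _))//.
have n0k : (n0 <= k.+1)%N by lia.
apply: (@le_trans _ _ (d * \sum_(i < k.+1) normc (h i) +
   (V + 1) * (\sum_(i < k.+1) normc (h i) - \sum_(i < n0) normc (h i)))).
  rewrite (big_ord_widen k.+1 (fun i => normc (h i)) n0k).
  rewrite [X in _ + _ * (X - _)](bigID (fun i : 'I_k.+1 => (i < n0)%N)) /=.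
  rewrite addrAC subrr add0r [X in _ + _ * X]big_mkcond /= !mulr_sumr -big_split.
  apply: ler_sum => i _; rewrite normcM /= mulrC.
  case: ltnP => ik; rewrite ?mulr0 ?addr0 ?ler_wpM2r ?normc_ge0 ?vd//.
    by have := ltn_ord i; lia.
  rewrite (le_trans (ler_wpM2r (normc_ge0 _) (vB _)))//.
  by rewrite lerDr mulr_ge0 ?normc_ge0// ltW.
have := hS k.+1; have := hn0 _ _ (leqnn n0) n0k; nra.
Qed.

End Convolution.

(** * Power series of a rational function without poles in the closed disk *)

Section QuotientSeries.
Variable R : realType.
Variables (D N : {poly R[i]}) (h : nat -> R[i]).
Hypothesis D0 : D != 0.
Hypothesis D_root : forall z, root D z -> 1 < normc z.
Hypothesis quot : forall n, 'X^n %| D * \poly_(i < n) h i - N.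

Let coef_quot n i : (i < n)%N -> (D * \poly_(i < n) h i)`_i = N`_i.
Proof.
by move=> /(dvdp_XnP _ _ (quot n)); rewrite coefB => /eqP; rewrite subr_eq0 => /eqP.
Qed.

(** Modulo ['X^n] the product of [D] with the truncated series is [N], so [inverse_bounds] bounds
    the truncation by a multiple of the l1 norm of [N], uniformly in [n]. *)
Lemma quotient_series_summable :
  exists S, forall n, \sum_(i < n) normc (h i) <= S.
Proof.
have [c [c0 cP _]] := inverse_bounds D0 D_root.
exists (c * coef_norm (size N) N) => n.
have -> : \sum_(i < n) normc (h i) = coef_norm n (\poly_(i < n) h i).
  by apply: eq_bigr => i _; rewrite coef_poly ltn_ord.
rewrite (le_trans (cP _ _))// ler_wpM2l//.
have -> : coef_norm n (D * \poly_(i < n) h i) = coef_norm n N.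
  by apply: eq_bigr => i _; rewrite coef_quot.
rewrite /coef_norm; have [nN|Nn] := leqP n (size N).
  rewrite (big_ord_widen _ (fun i => normc N`_i) nN).
  rewrite [leRHS](bigID (fun i : 'I_(size N) => (i < n)%N)) /=.
  by rewrite lerDl sumr_ge0// => i _; exact: normc_ge0.
rewrite (big_ord_widen _ (fun i => normc N`_i) (ltnW Nn)).
rewrite [leLHS](bigID (fun i : 'I_n => (i < size N)%N)) /=.
rewrite gerDl big1// => i; rewrite -leqNgt => ?.
by rewrite nth_default ?normc0.
Qed.

Lemma quotient_series_uniform e : 0 < e ->
  exists n0, forall n, (n0 <= n)%N -> forall z, normc z <= 1 ->
    normc (N.[z] / D.[z] - (\poly_(i < n) h i).[z]) <= e.
Proof.
move=> e0; have [c [c0 _ cz]] := inverse_bounds D0 D_root.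
have [C C0 CP] := coef_norm_mull D.
have [S hS] := quotient_series_summable.
have d0 : 0 < e / (c * C + 1) by rewrite divr_gt0// ltr_wpDl ?mulr_ge0.
have [n0 hn0] := nonneg_sum_tail (fun i => normc_ge0 (h i)) hS d0.
exists n0 => n n0n z z1; set T := \poly_(i < n) h i.
have Dz : D.[z] != 0.
  by apply/negP => /eqP Dz; have := cz _ z1; rewrite Dz normc0 mulr0 ler10.
have {1}-> : N.[z] / D.[z] - T.[z] = (N - D * T).[z] / D.[z].
  by rewrite hornerD hornerN hornerM; field.
(* With [k >= size Q] all coefficients of [Q] are counted. Modulo ['X^k], [N] is [D] times the
   longer truncation, so [Q] is [D] times a block of the tail of [h]. *)
set Q := N - D * T; pose k := maxn (size Q) n.
have nk : (n <= k)%N by rewrite leq_maxr.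
have Qz : normc Q.[z] <= C * (e / (c * C + 1)).
  rewrite (le_trans (@normc_horner_le _ k _ _ (leq_maxl _ _) z1))//.
  have -> : coef_norm k Q = coef_norm k (D * (\poly_(i < k) h i - T)).
    apply: eq_bigr => i _; congr normc.
    by rewrite mulrBr /Q !coefB (@coef_quot k).
  rewrite (le_trans (CP _ _))// ler_wpM2l// (le_trans _ (hn0 n k n0n nk))//.
  rewrite (big_ord_widen k (fun i => normc (h i)) nk).
  rewrite [X in _ <= X - _](bigID (fun i : 'I_k => (i < n)%N)) /= addrAC subrr add0r.
  rewrite [leRHS]big_mkcond ler_sum// => i _ /=.
  rewrite coefB !coef_poly ltn_ord; case: ltnP => _ /=; first by rewrite subrr normc0.
  by rewrite subr0.
have nD : 0 < normc D.[z] by rewrite lt_neqAle normc_ge0 andbT eq_sym normc_eq0.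
rewrite normcM normcV ler_pdivrMr// (le_trans Qz)//.
rewrite mulrA ler_pdivrMr ?ltr_wpDl ?mulr_ge0//.
rewrite [leLHS]mulrC -[leRHS]mulrA ler_pM2l//.
have := cz _ z1; set m := normc _ in nD *; nra.
Qed.

End QuotientSeries.

(** * Parseval on the unit circle *)

Section CircleIntegrals.
Variable R : realType.
Implicit Types (P Q : {poly R[i]}) (h : nat -> R[i]).
Local Notation mu := (@lebesgue_measure R).

Lemma normc_sqrE (z : R[i]) : normc z ^+ 2 = complex.Re z ^+ 2 + complex.Im z ^+ 2.
Proof. by case: z => a b /=; rewrite sqr_sqrtr ?addr_ge0 ?sqr_ge0. Qed.

Lemma normc_expi (t : R) : normc (expi t) = 1.
Proof. by rewrite /= cos2Dsin2 sqrtr1. Qed.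

(** The chain rule [d/dt P(e^(it)) = i e^(it) P'(e^(it))], split into real and imaginary parts so
    that only real derivatives occur. *)
Lemma is_derive_horner_expi P (t : R) :
  is_derive t 1 (fun s => complex.Re P.[expi s]) (- complex.Im (expi t * P^`().[expi t])) /\
  is_derive t 1 (fun s => complex.Im P.[expi s]) (complex.Re (expi t * P^`().[expi t])).
Proof.
elim/poly_ind: P => [|P a [IHr IHi]].
  rewrite derivC horner0 mulr0 /= oppr0.
  by split; (under eq_fun do rewrite horner0); exact: is_derive_cst.
rewrite derivD derivC addr0 derivM derivX mulr1 hornerD hornerMX.
have Er s : complex.Re (P * 'X + a%:P).[expi s] =
    complex.Re P.[expi s] * cos s - complex.Im P.[expi s] * sin s + complex.Re a.
  by rewrite hornerMXaddC; case: P.[_]; case: a.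
have Ei s : complex.Im (P * 'X + a%:P).[expi s] =
    complex.Re P.[expi s] * sin s + complex.Im P.[expi s] * cos s + complex.Im a.
  by rewrite hornerMXaddC; case: P.[_]; case: a {Er}.
split; [under eq_fun do rewrite Er | under eq_fun do rewrite Ei];
  apply: is_derive_eq; case: P.[_] => x1 x2; case: (P^`().[_]) => y1 y2;
  rewrite /GRing.scale /=; ring.
Qed.

Lemma continuous_horner_expi P (rho : R) :
  continuous (fun t : R => complex.Re P.[rho%:C * expi t]) /\
  continuous (fun t : R => complex.Im P.[rho%:C * expi t]).
Proof.
have E t : P.[rho%:C * expi t] = (P \Po (rho%:C *: 'X)).[expi t].
  by rewrite horner_comp hornerZ hornerX.
split; (under eq_fun do rewrite E) => t;
  apply: differentiable_continuous; apply/derivable1_diffP;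
  have [dr di] := is_derive_horner_expi (P \Po (rho%:C *: 'X)) t;
  exact: ex_derive.
Qed.

Lemma continuous_normc_quotient (D N : {poly R[i]}) (rho : R) :
  (forall t, D.[rho%:C * expi t] != 0) ->
  continuous (fun t : R => normc (N.[rho%:C * expi t] / D.[rho%:C * expi t]) ^+ 2).
Proof.
move=> D0; have [cNr cNi] := continuous_horner_expi N rho.
have [cDr cDi] := continuous_horner_expi D rho.
under eq_fun do rewrite normcM normcV exprMn exprVn !normc_sqrE !expr2.
move=> t; apply: cvgM; last apply: cvgV.
- by apply: cvgD; apply: cvgM; (exact: cNr || exact: cNi).
- by rewrite -!expr2 -normc_sqrE expf_neq0// normc_eq0.
- by apply: cvgD; apply: cvgM; (exact: cDr || exact: cDi).
Qed.

Lemma poly_antiderivative P : exists Q, Q^`() = P.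
Proof.
exists (\poly_(i < (size P).+1) (P`_i.-1 / i%:R)); apply/polyP => i.
rewrite coef_deriv coef_poly ltnS; case: ltnP => [_|/(nth_default 0) ->].
  by rewrite -[LHS]mulr_natr divfK// pnatr_eq0.
by rewrite mul0rn.
Qed.

Lemma expi0 : expi (0 : R) = 1.
Proof. by rewrite /expi cos0 sin0. Qed.

Lemma expi2pi : expi (2 * pi : R) = 1.
Proof. by rewrite /expi mulr_natl cos2pi sin2pi. Qed.

(* The cross terms of [|P z + a|^2] are [2 Re (z conj(a) P)], which on the
   circle is the derivative of the imaginary part of a polynomial in [expi t]. *)
Lemma primitive_normc_poly n h :
  exists F : R -> R,
    (forall t : R, is_derive t 1 F (normc (\poly_(i < n) h i).[expi t] ^+ 2)) /\
    F (2 * pi) - F 0 = 2 * pi * \sum_(i < n) normc (h i) ^+ 2.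
Proof.
elim: n h => [|n IH] h.
  exists (cst 0); split=> [t|]; last by rewrite subrr big_ord0 mulr0.
  by rewrite poly_def big_ord0 horner0 normc0 expr0n; exact: is_derive_cst.
have [F [dF F2pi]] := IH (fun i => h i.+1).
have -> : \poly_(i < n.+1) h i = (\poly_(i < n) h i.+1) * 'X + (h 0%N)%:P.
  apply/polyP => -[|i]; rewrite coefD coefMX coefC coef_poly /= ?add0r//.
  by rewrite addr0 coef_poly ltnS.
set P := \poly_(i < n) h i.+1 in dF *; set a := h 0%N.
have [Q dQ] := poly_antiderivative ((conjc a)%:P * P).
exists (fun t => F t + normc a ^+ 2 * t + 2 * complex.Im Q.[expi t]); split=> [t|].
  have [_ dI] := is_derive_horner_expi Q t.
  have dFt := dF t.
  apply: is_derive_eq; rewrite dQ hornerMXaddC hornerM hornerC.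
  rewrite !normc_sqrE /GRing.scale /=.
  have := sin2cos2 t.
  case: P.[_] => x1 x2; case: a {dQ} => y1 y2 /= cs.
  by ring: cs.
have -> : \sum_(i < n.+1) normc (h i) ^+ 2 =
    normc a ^+ 2 + \sum_(i < n) normc (h i.+1) ^+ 2 by rewrite big_ord_recl.
(* The term in [Q] takes the same value at both ends because [expi] closes up; only the linear term
   and the induction hypothesis remain. *)
by rewrite expi0 expi2pi [RHS]mulrDr -F2pi; ring.
Qed.

Lemma integral_normc_poly n h :
  (\int[mu]_(t in `[0%R, (2 * pi)%R]) (normc (\poly_(i < n) h i).[expi t] ^+ 2)%:E
   = (2 * pi * \sum_(i < n) normc (h i) ^+ 2)%:E)%E.
Proof.
have [F [dF F2pi]] := primitive_normc_poly n h.
have cF : continuous F.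
  move=> t; apply: differentiable_continuous; apply/derivable1_diffP.
  exact: ex_derive.
rewrite (@continuous_FTC2 _ _ F) ?EFinB -?F2pi//.
- by rewrite mulr_gt0 ?pi_gt0.
- apply: continuous_subspaceT => t.
  have := @continuous_normc_quotient 1 (\poly_(i < n) h i) 1.
  under eq_fun do rewrite hornerC invr1 mulr1 mul1r.
  by apply => s; rewrite hornerC oner_eq0.
- split; [by move=> t _; exact: ex_derive|..].
  + by apply: cvg_at_right_filter; exact: cF.
  + by apply: cvg_at_left_filter; exact: cF.
- by move=> t _; rewrite derive1E; exact: derive_val.
Qed.

End CircleIntegrals.

(** * Rational functions in the Hardy space *)

Section CircleGeometry.
Variable R : realType.
Implicit Types (D N : {poly R[i]}) (F : R[i] -> R[i]).
Local Notation mu := (@lebesgue_measure R).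

(** The strict bound on the angle leaves room in [[0, 2 pi]] for an arc starting at [th]. *)
Lemma expi_surj (z : R[i]) : normc z = 1 ->
  exists2 th : R, 0 <= th < 2 * pi & expi th = z.
Proof.
move=> z1; have: normc z ^+ 2 = 1 by rewrite z1 expr1n.
rewrite normc_sqrE; case: z {z1} => a b /= ab.
have a1 : -1 <= a <= 1 by have := sqr_ge0 b; move=> b2; apply/andP; split; nra.
have a1' : a \in `[(-1), 1] by rewrite in_itv.
have pi0 := pi_gt0 R; have := acos_lepi a1; have := acos_ge0 a1 => ge0 lepi.
have sE : sin (acos a) = `|b|.
  by rewrite sin_acos// -ab addrAC subrr add0r sqrtr_sqr.
have [b0|b0] := leP 0 b.
  exists (acos a); first by rewrite ge0 /=; lra.
  by rewrite /expi acosK// sE ger0_norm.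
(* Since [b < 0], the point is not 1; hence [acos a > 0] and the angle stays below [2 * pi]. *)
have a_lt1 : a < 1 by nra.
exists (2 * pi - acos a).
  by have := @acos_gt0 _ a; rewrite (andP a1).1 a_lt1 => /(_ isT); lra.
rewrite /expi addrC mulr_natl cosD2pi sinD2pi cosN sinN acosK// sE.
by rewrite ltr0_norm// opprK.
Qed.

(** The mean value theorem is applied to [cos] and [sin] separately, giving the factor [sqrt 2],
    which is rounded up to 2. *)
Lemma expi_lipschitz (s t : R) : s <= t -> normc (expi t - expi s) <= 2 * (t - s).
Proof.
move=> st.
have lip (f g : R -> R) : (forall x : R, is_derive x 1 f (g x)) ->
    (forall x, `|g x| <= 1) -> `|f t - f s| <= t - s.
  move=> df g1; have cf : {within `[s, t], continuous f}.
    apply: continuous_subspaceT => x; apply: differentiable_continuous.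
    by apply/derivable1_diffP; apply: ex_derive; exact: df.
  have [c _ ->] := MVT_segment st (fun x _ => df x) cf.
  by rewrite normrM [X in _ * X]ger0_norm ?subr_ge0// ler_piMl// subr_ge0.
have c1 : `|cos t - cos s| <= t - s.
  apply: (lip cos (fun x => - sin x)) => x.
  by rewrite normrN ler_norml sin_geN1 sin_le1.
have s1 : `|sin t - sin s| <= t - s.
  by apply: (lip sin cos) => x; rewrite ler_norml cos_geN1 cos_le1.
rewrite -ler_sqr ?nnegrE ?normc_ge0 ?mulr_ge0 ?subr_ge0// normc_sqrE /=.
have sq x y : `|x| <= y -> x ^+ 2 <= y ^+ 2 :> R.
  by move=> xy; rewrite -real_normK ?num_real// ler_sqr ?nnegrE// (le_trans _ xy).
by have := sq _ _ c1; have := sq _ _ s1; have := sqr_ge0 (t - s); lra.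
Qed.

Lemma unit_diskE (z : R[i]) : unit_disk R z <-> normc z < 1.
Proof. by rewrite /unit_disk /= normcE_norm -[1]/(1%:C) ltcR. Qed.

Lemma normc_real (x : R) : normc x%:C = `|x|.
Proof. by rewrite /= expr0n addr0 sqrtr_sqr. Qed.

Lemma normc_scaled_expi (rho t : R) : 0 <= rho -> normc (rho%:C * expi t) = rho.
Proof. by move=> rho0; rewrite normcM normc_expi mulr1 normc_real ger0_norm. Qed.

Lemma circle_mean_lower (f : R -> R[i]) (k th e : R) :
  continuous (fun t => normc (f t) ^+ 2) -> 0 <= k -> 0 <= th -> 0 <= e ->
  th + e <= 2 * pi -> (forall t, th <= t <= th + e -> k <= normc (f t) ^+ 2) ->
  (((2 * pi)^-1 * (k * e))%:E <= circle_mean f)%E.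
Proof.
move=> cf k0 th0 e0 the fk; rewrite /circle_mean EFinM lee_pmul2l//; last first.
  by rewrite lte_fin invr_gt0 mulr_gt0 ?pi_gt0.
apply: (@le_trans _ _ (\int[mu]_(t in `[th, (th + e)%R]) (normc (f t) ^+ 2)%:E)%E).
  have -> : (k * e)%:E = (\int[mu]_(t in `[th, (th + e)%R]) (cst k%:E t))%E.
    rewrite integral_cst//= lebesgue_measure_itv /= lte_fin ltrDl.
    case: ltP => [_|e0']; first by rewrite -EFinB addrAC subrr add0r.
    by rewrite mule0 (_ : e = 0) ?mulr0//; apply/le_anti; rewrite e0 e0'.
  apply: ge0_le_integral => //.
  by apply/measurable_EFinP; apply: measurable_funTS; exact: continuous_measurable_fun.
apply: ge0_subset_integral => //.
  by apply/measurable_EFinP; apply: measurable_funTS; exact: continuous_measurable_fun.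
  by move=> t _; rewrite lee_fin sqr_ge0.
by move=> t /=; rewrite !in_itv /= => /andP[t1 t2]; apply/andP; split; lra.
Qed.

(* Near a zero of the denominator on the circle, [F] exceeds a multiple of
   [1 / (1 - rho)] on an arc of length [1 - rho] of the circle of radius
   [rho]. *)
Lemma H2_no_pole_on_circle F D N :
  in_H2 F -> coprimep D N ->
  (forall z, normc z < 1 -> D.[z] != 0 /\ F z = N.[z] / D.[z]) ->
  forall z, normc z = 1 -> D.[z] != 0.
Proof.
move=> [_ supF] copDN FE z z1; apply/negP => /eqP Dz.
have Nz : N.[z] != 0 by apply: (coprimep_root copDN); apply/eqP.
have [th /andP[th0 th2pi] thz] := expi_surj z1.
have [L L0 DL] := horner_lipschitz D; have [M M0 NM] := horner_lipschitz N.
set c := normc N.[z]; have c0 : 0 < c.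
  by rewrite lt_neqAle normc_ge0 andbT eq_sym normc_eq0.
(* On an arc of angle [e] at radius [1 - e], points are within [3 * e] of [z]: [e] radially and
   [2 * e] along the arc. There [|N| >= c / 2] and [|D| <= 3 (L + 1) e], so the mean is at least
   [K / e]. *)
pose K := (2 * pi)^-1 * (c / 2 / (3 * (L + 1))) ^+ 2.
have L1 : 0 < 3 * (L + 1) by lra.
have K0 : 0 < K.
  apply: mulr_gt0; first by rewrite invr_gt0 mulr_gt0 ?pi_gt0.
  by apply: exprn_gt0; rewrite !divr_gt0.
have mean_ge e : 0 < e -> e < 1 -> th + e <= 2 * pi -> 3 * M * e <= c / 2 ->
  ((K / e)%:E <= ereal_sup [set circle_mean (fun t => F (rho%:C * expi t)%R) |
              rho in [set rho : R | (0 < rho < 1)%R]])%E.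
  move=> e0 e1 the Me.
  apply: le_trans (ereal_sup_ubound _); last first.
    by exists (1 - e) => //=; lra.
  set rho := 1 - e; have rho0 : 0 <= rho by rewrite /rho; lra.
  have rho1 t : normc (rho%:C * expi t) < 1.
    by rewrite normc_scaled_expi//; rewrite /rho; lra.
  have FE' : (fun t => F (rho%:C * expi t)) =
      (fun t => N.[rho%:C * expi t] / D.[rho%:C * expi t]).
    by apply/funext => t; exact: (FE _ (rho1 t)).2.
  have -> : K / e = (2 * pi)^-1 * ((c / 2 / (3 * (L + 1) * e)) ^+ 2 * e).
    by rewrite /K; field; rewrite !gt_eqF ?pi_gt0//; lra.
  rewrite FE'; apply: (@circle_mean_lower _ _ th) => //; [|exact: sqr_ge0|exact: ltW|].
    by apply: continuous_normc_quotient => t; exact: (FE _ (rho1 t)).1.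
  move=> t /andP[tht tth]; set w := rho%:C * expi t.
  have wz : normc (w - z) <= 3 * e.
    have -> : w - z = (rho - 1)%:C * expi t + (expi t - z).
      by rewrite rmorphB rmorph1 mulrBl mul1r addrA subrK.
    rewrite (le_trans (le_normcD _ _))// normcM normc_expi mulr1 normc_real.
    have := expi_lipschitz tht; rewrite thz.
    rewrite (_ : `|rho - 1| = e); first by move=> ?; lra.
    by rewrite /rho addrAC subrr add0r normrN gtr0_norm.
  have w1 : normc w <= 1 by exact: ltW (rho1 t).
  have z1' : normc z <= 1 by rewrite z1.
  have Nw : c / 2 <= normc N.[w].
    have := le_normc_distD N.[z] N.[w]; have := NM _ _ w1 z1'.
    rewrite -[normc (N.[z] - _)]normcN opprB -/c.
    have := ler_wpM2l M0 wz; lra.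
  have Dw : normc D.[w] <= 3 * (L + 1) * e.
    have := DL _ _ w1 z1'; rewrite Dz subr0 => /le_trans -> //.
    by have := ler_wpM2l L0 wz; nra.
  have D0 : 0 < normc D.[w].
    by rewrite lt_neqAle normc_ge0 andbT eq_sym normc_eq0 (FE _ (rho1 t)).1.
  have L1e : 0 < 3 * (L + 1) * e by rewrite mulr_gt0.
  have c20 : 0 <= c / 2 by rewrite divr_ge0// ltW.
  have le : c / 2 / (3 * (L + 1) * e) <= normc N.[w] * (normc D.[w])^-1%R.
    by apply: ler_pM => //; [rewrite invr_ge0 ltW|rewrite lef_pV2].
  rewrite normcM normcV; apply: lerXn2r => //; rewrite nnegrE.
    by rewrite divr_ge0// ltW.
  by rewrite divr_ge0// normc_ge0.
set S := ereal_sup _ in supF mean_ge.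
have [e [e0 [e1 [the Me]]]] : exists e, 0 < e /\
    (e < 1 /\ (th + e <= 2 * pi /\ 3 * M * e <= c / 2)).
  pose e := Order.min (1 / 2) (Order.min (2 * pi - th) (c / 2 / (3 * M + 1))).
  have e1 : e <= 1 / 2 by rewrite ge_min lexx.
  have e2 : e <= 2 * pi - th by rewrite !ge_min lexx orbT.
  have e3 : e <= c / 2 / (3 * M + 1) by rewrite !ge_min lexx !orbT.
  exists e; split; [|split; [lra|split; [lra|]]].
    rewrite !lt_min subr_gt0 th2pi !divr_gt0// ltr_wpDl// mulr_ge0//.
  move: e3; rewrite ler_pdivlMr ?ltr_wpDl ?mulr_ge0// => e3.
  have : 0 <= e by rewrite !le_min subr_ge0 (ltW th2pi) !divr_ge0 ?ltW ?ltr_wpDl ?mulr_ge0.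
  lra.
have := mean_ge _ e0 e1 the Me; case: S supF mean_ge => [B| |]//= _ mean_ge _.
(* [B] is the finite supremum; this radius makes [K / d] exceed it. *)
pose d := Order.min e (K / (`|B| + 1)).
have B0 : 0 < `|B| + 1 by rewrite ltr_wpDl.
have d0 : 0 < d by rewrite lt_min e0 divr_gt0.
have de : d <= e by rewrite ge_min lexx.
have dK : d <= K / (`|B| + 1) by rewrite ge_min lexx orbT.
have : K / d <= B by rewrite -lee_fin mean_ge//; nra.
rewrite ler_pdivrMr// => KB; move: dK; rewrite ler_pdivlMr// => dK.
by have := ler_norm B; nra.
Qed.

Lemma boundary_value_quotient F D N (t : R) :
  (forall z, normc z < 1 -> F z = N.[z] / D.[z]) ->
  (forall z, normc z <= 1 -> D.[z] != 0) ->
  boundary_value F t = N.[expi t] / D.[expi t].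
Proof.
move=> FE D0; apply: (@cvg_lim (R[i])^o); first exact: norm_hausdorff.
have z1 : normc (expi t) <= 1 by rewrite normc_expi.
set z := expi t in z1 *.
(* [P] vanishes at [z], and the difference of the quotients at [z] and [w] is
   [(P(z) - P(w)) / (D(z) D(w))], so one Lipschitz bound controls it. *)
pose P := D.[z] *: N - N.[z] *: D.
have [L L0 PL] := horner_lipschitz P; have [M M0 DM] := horner_lipschitz D.
have nD0 w : normc w <= 1 -> 0 < normc D.[w].
  by move=> /D0 ?; rewrite lt_neqAle normc_ge0 andbT eq_sym normc_eq0.
set d := normc D.[z]; have d0 : 0 < d by exact: nD0.
apply/cvgrPdist_le => eps eps0.
have [e e0 ->] : exists2 e : R, 0 < e & eps = e%:C.
  by case: eps eps0 => a b; rewrite ltcE /= => /andP[/eqP -> ?]; exists a.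
(* The first bound keeps [|D(w)| >= d / 2]; the second makes the numerator at most
   [e * d ^+ 2 / 2]. *)
pose q := Order.min (d / 2 / (M + 1)) (e * d ^+ 2 / 2 / (L + 1)).
have q0 : 0 < q by rewrite lt_min !divr_gt0 ?mulr_gt0 ?exprn_gt0 ?ltr_wpDl.
near=> rho.
have rho1 : rho < 1 by near: rho; exact: nbhs_left_lt.
have rho0 : 0 < rho by near: rho; exact: nbhs_left_gt.
have rhoq : 1 - q < rho by near: rho; apply: nbhs_left_gt; rewrite ltrBlDr ltrDl.
set w := rho%:C * z; have w1 : normc w < 1 by rewrite normc_scaled_expi// ltW.
have zw : normc (z - w) <= q.
  have -> : z - w = (1 - rho)%:C * z by rewrite rmorphB rmorph1 mulrBl mul1r.
  by rewrite normcM normc_expi mulr1 normc_real ger0_norm; lra.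
rewrite normcE_norm lecR FE//.
have Dw := nD0 _ (ltW w1).
have -> : N.[z] / D.[z] - N.[w] / D.[w] = P.[z] / (D.[z] * D.[w]) - P.[w] / (D.[z] * D.[w]).
  rewrite /P !hornerD !hornerN !hornerZ.
  by field; rewrite !D0// ltW.
rewrite -mulrBl normcM normcV normcM -/d ler_pdivrMr ?mulr_gt0//.
have wd : d / 2 <= normc D.[w].
  have := le_normc_distD D.[z] D.[w]; have := DM _ _ z1 (ltW w1); rewrite -/d.
  have : q <= d / 2 / (M + 1) by rewrite ge_min lexx.
  rewrite ler_pdivlMr ?ltr_wpDl// => qM.
  have := ler_wpM2l M0 zw; lra.
have : q <= e * d ^+ 2 / 2 / (L + 1) by rewrite ge_min lexx orbT.
rewrite ler_pdivlMr ?ltr_wpDl// => qL.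
rewrite (le_trans (PL _ _ z1 (ltW w1)))//.
have := ler_wpM2l L0 zw.
have : d ^+ 2 / 2 <= d * normc D.[w] by nra.
by move=> /(ler_wpM2l (ltW e0)); lra.
Unshelve. all: by end_near.
Qed.

End CircleGeometry.

Section RationalH2.
Variable R : realType.
Implicit Types (D N : {poly R[i]}) (F : R[i] -> R[i]) (h : nat -> R[i]).
Local Notation mu := (@lebesgue_measure R).
Local Notation C := (R[i])^o.

Lemma continuous_hornerc (P : {poly R[i]}) : continuous (horner P : C -> C).
Proof.
move=> z; elim/poly_ind: P => [|P a IH].
  rewrite (_ : horner 0 = cst 0); first exact: cst_continuous.
  by apply/funext => w; rewrite horner0.
rewrite (_ : horner _ = fun w => P.[w] * w + a); last first.
  by apply/funext => w; rewrite hornerMXaddC.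
have cid : {for z, continuous (id : C -> C)} by [].
exact: (cvgD (@continuousM _ _ (horner P : C -> C) id _ IH cid) (cvg_cst (a : C))).
Qed.

Lemma near_unit_disk (z : R[i]) : normc z < 1 ->
  \forall w \near (z : C), normc w < 1.
Proof.
move=> z1; have e0 : 0 < (1 - normc z)%:C by rewrite ltcR subr_gt0.
have := @nbhsx_ballx _ C z _ e0; rewrite -ball_normE => nz.
near=> w.
have : `|(z : C) - w| < (1 - normc z)%:C by near: w.
rewrite (normcE_norm (z - w)) ltcR => zw.
have := le_normc_distD w z; rewrite -[normc (w - z)]normcN opprB => ?; lra.
Unshelve. all: by end_near.
Qed.

Lemma near_punctured_root D (z : R[i]) : D != 0 ->
  \forall w \near (z : C)^', D.[w] != 0.
Proof.
move=> D0; have [m [S]] := multiplicity_XsubC D z.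
rewrite D0 /= => Sz ->.
have nS : \forall w \near (z : C), S.[w] != 0.
  exact: (@cvgr_neq0 _ C C _ (nbhs_filter (z : C)) (horner S) _
    (@continuous_hornerc S z) Sz).
near=> w; rewrite hornerM horner_exp hornerXsubC mulf_neq0//.
  by near: w; exact: nbhs_dnbhs.
by rewrite expf_neq0// subr_eq0; near: w; exact: (@nbhs_dnbhs_neq C z).
Unshelve. all: by end_near.
Qed.

(** Both sides are continuous and the zeros of [D] are isolated. This recovers the identity at
    points where [phi z] is an eigenvalue of [A] and the resolvent formula says nothing. *)
Lemma analytic_quotient_extension F D D1 N1 : analytic_on (unit_disk R) F ->
  D != 0 ->
  (forall z, normc z < 1 -> D.[z] != 0 -> D1.[z] * F z = N1.[z]) ->
  forall z, normc z < 1 -> D1.[z] * F z = N1.[z].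
Proof.
move=> anF D0 FE z z1; apply/eqP; rewrite -subr_eq0; apply/eqP.
have cF : {for (z : C), continuous (F : C -> C)}.
  apply: differentiable_continuous; apply/derivable1_diffP.
  by apply: anF; apply/unit_diskE.
have ck : (D1.[w] * F w - N1.[w] : C) @[w --> (z : C)^'] --> (D1.[z] * F z - N1.[z] : C).
  apply: cvg_trans; first exact: cvg_app (@nbhs_dnbhs _ _).
  have cDF := @continuousM _ _ (horner D1 : C -> C) F _ (@continuous_hornerc _ _) cF.
  exact: (cvgB cDF (@continuous_hornerc N1 z)).
apply: (cvg_unique _ ck); first exact: norm_hausdorff.
apply: cvg_near_cst.
have nz : \forall w \near (z : C)^', normc w < 1.
  by apply: nbhs_dnbhs; exact: near_unit_disk.
near=> w; apply/eqP; rewrite subr_eq0; apply/eqP; apply: FE.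
  by near: w.
by near: w; exact: near_punctured_root.
Unshelve. all: by end_near.
Qed.

(** In lowest terms [D1 F = N1] on the disk, so a zero of [D1] there would be a common zero of [D1]
    and [N1]. The relation [D * N1 = N * D1] later carries the recurrence identity over to the
    reduced fraction. *)
Lemma H2_rational F D N : in_H2 F -> D != 0 ->
  (forall z, normc z < 1 -> D.[z] != 0 -> D.[z] * F z = N.[z]) ->
  exists D1 N1, [/\ D * N1 = N * D1,
    forall z, normc z <= 1 -> D1.[z] != 0 &
    forall z, normc z < 1 -> F z = N1.[z] / D1.[z]].
Proof.
move=> H2F D0 FE; pose g := gcdp D N.
have g0 : g != 0 by rewrite gcdp_eq0 negb_and D0.
pose D1 := D %/ g; pose N1 := N %/ g.
have DE : D = D1 * g by rewrite divpK// dvdp_gcdl.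
have NE : N = N1 * g by rewrite divpK// dvdp_gcdr.
have cop : coprimep D1 N1 by rewrite coprimep_div_gcd// D0.
have F1 z : normc z < 1 -> D1.[z] * F z = N1.[z].
  move: z; apply: (@analytic_quotient_extension _ D) => // [|z z1 Dz].
    exact: H2F.1.
  have gz : g.[z] != 0.
    by apply: contraNneq Dz => gz; rewrite DE hornerM gz mulr0.
  apply: (mulfI gz); rewrite mulrA -!hornerM [g * D1]mulrC [g * N1]mulrC -DE -NE.
  exact: FE.
have D1z z : normc z < 1 -> D1.[z] != 0.
  move=> z1; apply/negP => Dz; have := coprimep_root cop Dz.
  by rewrite -F1// (eqP Dz) mul0r eqxx.
have F2 z : normc z < 1 -> F z = N1.[z] / D1.[z].
  by move=> z1; rewrite -F1// mulrAC mulfV ?mul1r// D1z.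
exists D1, N1; split=> //.
  by rewrite DE NE mulrAC [RHS]mulrAC [N1 * D1]mulrC.
move=> z; rewrite le_eqVlt => /predU1P[z1|]; last exact: D1z.
by apply: (H2_no_pole_on_circle H2F cop) => // w w1; split; [exact: D1z|exact: F2].
Qed.

Lemma quotient_series_Bessel D N h k : D != 0 ->
  (forall z, normc z <= 1 -> D.[z] != 0) ->
  (forall n, 'X^n %| D * \poly_(i < n) h i - N) ->
  ((\sum_(i < k) normc (h i) ^+ 2)%R%:E <=
   circle_mean (fun t => N.[expi t] / D.[expi t])%R)%E.
Proof.
move=> D0 Dz quot.
have rD z : root D z -> 1 < normc z.
  by rewrite ltNge => Dr; apply/negP => /Dz; rewrite /root in Dr; rewrite Dr.
have [S hS] := quotient_series_summable D0 rD quot.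
have S0 : 0 <= S by rewrite (le_trans _ (hS 0%N))// big_ord0.
have pi20 : 0 < 2 * pi :> R by rewrite mulr_gt0 ?pi_gt0.
set H := fun t => _ / _.
have cH : continuous (fun t : R => normc (H t) ^+ 2).
  have := @continuous_normc_quotient R D N 1.
  under eq_fun do rewrite mul1r.
  by apply => t; rewrite mul1r Dz// normc_expi.
suff le : ((2 * pi * \sum_(i < k) normc (h i) ^+ 2)%R%:E <=
    \int[mu]_(t in `[0%R, (2 * pi)%R]) (normc (H t) ^+ 2)%:E)%E.
  rewrite /circle_mean -[X in (X%:E <= _)%E](mulKf (lt0r_neq0 pi20)) EFinM.
  by rewrite lee_pmul2l// lte_fin invr_gt0.
apply/lee_addgt0Pr => e e0.
(* A uniform error [d] changes the squared modulus by at most [2 * S * d], and integration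
   multiplies this by [2 * pi]. *)
pose d := e / (2 * pi * (2 * S + 1)).
have S21 : 0 < 2 * S + 1 by lra.
have d0 : 0 < d by rewrite divr_gt0// mulr_gt0.
have [n0 near_H] := quotient_series_uniform D0 rD quot d0.
pose n := maxn n0 k.
apply: (@le_trans _ _ (2 * pi * \sum_(i < n) normc (h i) ^+ 2)%R%:E).
  rewrite lee_fin ler_pM2l//.
  rewrite (big_ord_widen n (fun i => normc (h i) ^+ 2) (leq_maxr _ _)).
  rewrite [leRHS](bigID (fun i : 'I_n => (i < k)%N)) /=.
  by rewrite lerDl sumr_ge0// => i _; exact: sqr_ge0.
rewrite -integral_normc_poly.
pose a := d * (2 * S).
have a0 : 0 <= a by apply: mulr_ge0; [exact: ltW|lra].
apply: (@le_trans _ _ (\int[mu]_(t in `[0%R, (2 * pi)%R]) ((normc (H t) ^+ 2)%:E + cst a%:E t))%E).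
  apply: ge0_le_integral => //.
  - by move=> t _; rewrite lee_fin sqr_ge0.
  - apply/measurable_EFinP; apply: measurable_funTS; apply: continuous_measurable_fun.
    have := @continuous_normc_quotient R 1 (\poly_(i < n) h i) 1.
    under eq_fun do rewrite hornerC invr1 mulr1 mul1r.
    by apply => t; rewrite hornerC oner_eq0.
  - apply: emeasurable_funD => //.
    by apply/measurable_EFinP; apply: measurable_funTS; exact: continuous_measurable_fun.
  - move=> t _; rewrite /= -EFinD lee_fin.
    have z1 : normc (expi t) <= 1 by rewrite normc_expi.
    have := near_H n (leq_maxl _ _) _ z1; rewrite -/(H t).
    set T := (\poly_(i < n) h i).[expi t] => HT.
    have TS : normc T <= S.
      apply: le_trans (hS n).
      rewrite (le_trans (normc_horner_le (size_poly n h) z1))//.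
      by apply: ler_sum => i _; rewrite coef_poly ltn_ord.
    have := le_normc_distD T (H t); rewrite -[normc (T - _)]normcN opprB => TH.
    have dS : d * normc T <= d * S by rewrite ler_wpM2l// ltW.
    have TdH : normc T - d <= normc (H t) by lra.
    have := normc_ge0 (H t); have := normc_ge0 T; rewrite /a.
    move: (normc T) (normc (H t)) TdH dS d0 S0 => x y xy dS d0' S0' x0 y0.
    (* Squaring [x - d <= y] requires [x - d >= 0]; for [x <= d] the bound follows from
       [x ^+ 2 <= d * x <= d * S]. *)
    have [xd|xd] := leP x d; first by nra.
    have : (x - d) ^+ 2 <= y ^+ 2 by rewrite ler_sqr ?nnegrE// subr_ge0 ltW.
    have := sqr_ge0 d; lra.
rewrite ge0_integralD//=; last 2 first.
- by move=> t _; rewrite lee_fin sqr_ge0.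
- by apply/measurable_EFinP; apply: measurable_funTS; exact: continuous_measurable_fun.
rewrite leeD2l// integral_cst//= lebesgue_measure_itv /= lte_fin pi20 -EFinB subr0.
rewrite -EFinM lee_fin /a.
have : d * (2 * S + 1) * (2 * pi) = e.
  by rewrite -mulrA [X in d * X]mulrC divfK// gt_eqF// mulr_gt0.
have := mulr_gt0 d0 pi20; lra.
Qed.

End RationalH2.

(** * Transfer functions of the two systems *)

Section TransferPolynomials.
Variable R : realType.
Local Notation C := R[i].

(** The Z-transform truncated before time [K], with ['X] in the role of the unit delay [z^-1]. *)
Definition series_poly (f : int -> C) K : {poly C} := \poly_(i < K) f i%:Z.

(** By Cramer's rule, the numerator of the transfer function [c M^-1 B] over the denominator
    [\det M]. *)
Definition transfer_num n (M : 'M[{poly C}]_n) (B : 'cV_n) (c : 'rV[C]_n) : {poly C} :=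
  (map_mx polyC c *m (\adj M *m B)) 0 0.

Lemma transfer_series n (M : 'M[{poly C}]_n) B (c : 'rV_n) (x : int -> 'cV_n)
    (u : int -> C) K :
  (forall l, 'X^K %| (M *m \col_m series_poly (fun k => x k m 0) K
                      - series_poly u K *: B) l 0) ->
  'X^K %| \det M * series_poly (fun k => (c *m x k) 0 0) K
          - transfer_num M B c * series_poly u K.
Proof.
set X := \col_m _; set U := series_poly u K => dv.
pose Z := \col_l ((M *m X - U *: B) l 0 %/ 'X^K).
have MX : M *m X = U *: B + 'X^K *: Z.
  apply/eqP; rewrite addrC -subr_eq; apply/eqP/matrixP => l j.
  by rewrite !ord1 [RHS]mxE [Z l 0]mxE mulrC divpK.
have -> : series_poly (fun k => (c *m x k) 0 0) K = (map_mx polyC c *m X) 0 0.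
  apply/polyP => i; rewrite coef_poly !mxE coef_sum.
  under [RHS]eq_bigr => m _ do rewrite !mxE coefCM coef_poly.
  by case: ifP => iK; [apply: eq_bigr | rewrite big1// => m _; rewrite mulr0].
have -> : \det M * (map_mx polyC c *m X) 0 0 = (map_mx polyC c *m (\det M *: X)) 0 0.
  by rewrite -scalemxAr [RHS]mxE.
rewrite (det_scale_solution MX) mulmxDr -!scalemxAr /transfer_num.
move: (_ *m (_ *m B)) (_ *m (_ *m Z)) => P Q.
by rewrite !mxE mulrC addrAC subrr add0r dvdp_mulr.
Qed.

(** The pointwise counterpart of [transfer_series]: at [z], [\adj M *m B] is [\adj M *m M *m v],
    that is [\det M] times [v]. *)
Lemma transfer_horner n (M : 'M[{poly C}]_n) B (c : 'rV_n) (v : 'cV_n) z :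
  map_mx (horner_eval z) M *m v = map_mx (horner_eval z) B ->
  (\det M).[z] * (c *m v) 0 0 = (transfer_num M B c).[z].
Proof.
move=> Mv; rewrite /transfer_num -!/(horner_eval z _) -det_map_mx.
have -> : horner_eval z ((map_mx polyC c *m (\adj M *m B)) 0 0) =
    (map_mx (horner_eval z) (map_mx polyC c *m (\adj M *m B))) 0 0.
  by rewrite [RHS]mxE.
rewrite !map_mxM map_mx_adj -Mv -map_mx_comp.
rewrite (_ : map_mx _ c = c); last first.
  by apply/matrixP => i j; rewrite mxE /= /horner_eval hornerC.
by rewrite (mulmxA (\adj _)) mul_adj_mx mul_scalar_mx -scalemxAr [RHS]mxE.
Qed.

Lemma sum_ord_trunc (V : nmodType) (g : nat -> V) a b :
  (forall j, (a <= j)%N -> g j = 0) -> (a <= b)%N ->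
  \sum_(j < b) g j = \sum_(j < a) g j.
Proof.
move=> g0 ab; rewrite (big_ord_widen b g ab) [RHS]big_mkcond /=.
by apply: eq_bigr => j _; case: ltnP => // /g0.
Qed.

Lemma coef_delay (p : {poly C}) (f : int -> C) d K k : (size p <= d.+1)%N ->
  (forall l : int, - d%:Z <= l <= 0 -> f l = 0) -> (k < K)%N ->
  (p * series_poly f K)`_k = \sum_(j < d.+1) p`_j * f (k%:Z - j%:Z).
Proof.
move=> sp f0 kK; rewrite coefM.
(* The Cauchy product stops at [k], the recurrence at [d]. Terms beyond [d] vanish by the size of
   [p], those beyond [k] by the zero initial conditions. *)
pose g j := if (j <= k)%N then p`_j * f (k%:Z - j%:Z) else 0.
transitivity (\sum_(j < k.+1) g j).
  apply: eq_bigr => j _; have jk : (j <= k)%N by rewrite -ltnS.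
  rewrite /g jk coef_poly (leq_ltn_trans (leq_subr _ _) kK).
  by rewrite subzn.
transitivity (\sum_(j < maxn k.+1 d.+1) g j).
  by rewrite (sum_ord_trunc _ (leq_maxl _ _))// => j kj; rewrite /g leqNgt kj.
rewrite (sum_ord_trunc _ (leq_maxr _ _)) => [|j dj]; last first.
  by rewrite /g nth_default ?mul0r ?if_same// (leq_trans sp).
apply: eq_bigr => j _; rewrite /g; case: leqP => // kj.
by rewrite f0 ?mulr0//; have := ltn_ord j; lia.
Qed.

Lemma series_poly_mulmx m n (A : 'M[C]_(m, n)) (x : int -> 'cV[C]_n) K l :
  (map_mx polyC A *m \col_j series_poly (fun k => x k j 0) K) l 0 =
  series_poly (fun k => (A *m x k) l 0) K.
Proof.
apply/polyP => i; rewrite coef_poly !mxE coef_sum.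
under eq_bigr => j _ do rewrite !mxE coefCM coef_poly.
by case: ifP => // _; rewrite big1// => j _; rewrite mulr0.
Qed.

Definition delay_pencil n (p q : {poly C}) (A : 'M[C]_n) : 'M[{poly C}]_n :=
  p%:M - q *: map_mx polyC A.

Lemma delay_system_pencil np nq n (p q : {poly C}) (A : 'M[C]_n) (b c : 'cV[C]_n)
    (u : int -> C) (x : int -> 'cV[C]_n) (y : int -> C) K l :
  size p = np.+1 -> size q = nq.+1 -> (forall k, k <= 0 -> u k = 0) ->
  delay_system np nq p q A b c u x y ->
  'X^K %| (delay_pencil p q A *m \col_m series_poly (fun k => x k m 0) K
           - series_poly u K *: (q *: map_mx polyC b)) l 0.
Proof.
move=> sp sq u0 [x0 xE _]; set X := \col_m _.
have -> : (delay_pencil p q A *m X - series_poly u K *: (q *: map_mx polyC b)) l 0 =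
    p * series_poly (fun k => x k l 0) K
    - q * series_poly (fun k => (A *m x k) l 0) K - q * series_poly u K * (b l 0)%:P.
  rewrite -series_poly_mulmx /delay_pencil mulmxBl mul_scalar_mx -scalemxAl -/X.
  move: (_ *m X) => AX; rewrite !mxE; ring.
apply/dvdp_XnP => k kK; rewrite !coefB [_ * (b l 0)%:P]mulrC coefCM.
have x0' d (f : int -> C) : (d <= maxn np nq)%N -> (forall k, x k = 0 -> f k = 0) ->
    forall m : int, - d%:Z <= m <= 0 -> f m = 0.
  by move=> dn f0 m m0; apply: f0; apply: x0; lia.
rewrite (@coef_delay p _ np) ?sp//; last first.
  by apply: x0'; [exact: leq_maxl|move=> m ->; rewrite mxE].
rewrite (@coef_delay q (fun k => (A *m x k) l 0) nq) ?sq//; last first.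
  by apply: x0'; [exact: leq_maxr|move=> m ->; rewrite mulmx0 mxE].
rewrite (@coef_delay q u nq) ?sq//; last by move=> m /andP[_]; exact: u0.
(* The recurrence starts at time 1; at time 0 every delayed value is an initial condition or an
   input at a nonpositive time, hence zero. *)
case: k kK => [|k] kK.
  rewrite !big1 ?mulr0 ?subr0// => j _.
  - by rewrite u0 ?mulr0//; lia.
  - by rewrite x0 ?mulmx0 ?mxE ?mulr0//; have := ltn_ord j; lia.
  - by rewrite x0 ?mxE ?mulr0//; have := ltn_ord j; lia.
have sumE m (a : nat -> C) (v : nat -> 'cV[C]_n) :
    (\sum_(j < m) a j *: v j) l 0 = \sum_(j < m) a j * v j l 0.
  by rewrite summxE; apply: eq_bigr => j _; rewrite mxE.
have := congr1 (fun V : 'cV[C]_n => V l 0) (xE k.+1%:Z isT).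
rewrite mxE [X in _ + X]mxE (sumE _ _ (fun j => x (k.+1%:Z - j%:Z))).
rewrite (sumE _ _ (fun j => A *m x (k.+1%:Z - j%:Z))) [RHS]mxE => ->.
by rewrite mulrC subrr.
Qed.

Definition descriptor_pencil r (Er Ar : 'M[C]_r) : 'M[{poly C}]_r :=
  'X *: map_mx polyC Er - map_mx polyC Ar.

Lemma reduced_system_pencil r (Er Ar : 'M[C]_r) (br cr : 'cV[C]_r) dr
    (u : int -> C) (x : int -> 'cV[C]_r) (y : int -> C) K l :
  (forall k, k <= 0 -> u k = 0) ->
  reduced_system Er Ar br cr dr u x y ->
  'X^K %| (descriptor_pencil Er Ar *m \col_m series_poly (fun k => x k m 0) K
           - series_poly u K *: map_mx polyC br) l 0.
Proof.
move=> u0 [x0 xE _]; set X := \col_m _.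
have -> : (descriptor_pencil Er Ar *m X - series_poly u K *: map_mx polyC br) l 0 =
    'X * series_poly (fun k => (Er *m x k) l 0) K
    - series_poly (fun k => (Ar *m x k) l 0) K - (br l 0)%:P * series_poly u K.
  rewrite -!series_poly_mulmx /descriptor_pencil mulmxBl -scalemxAl -/X.
  move: (map_mx polyC Er *m X) (map_mx polyC Ar *m X) => EX AX; rewrite !mxE; ring.
apply/dvdp_XnP => k kK; rewrite !coefB coefCM coefXM !coef_poly kK.
case: k kK => [|k] kK /=.
  by rewrite x0// u0// mulmx0 mxE subrr mulr0 subr0.
rewrite (ltnW kK) xE// -[k.+1%:Z - 1](_ : k%:Z = _); last by lia.
by rewrite !mxE; ring.
Qed.

(** A kernel vector of [z *: Er - Ar] is an eigenvector of the pencil for [z]. As [det0P] gives a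
    left kernel vector, the determinant is transposed first. *)
Lemma descriptor_pencil_det_neq0 r (Er Ar : 'M[C]_r) :
  (forall lam, pencil_eigenvalue Ar Er lam -> 1 < `|lam|) ->
  forall z, normc z <= 1 -> (\det (descriptor_pencil Er Ar)).[z] != 0.
Proof.
move=> stable z z1; rewrite -/(horner_eval z _) -det_map_mx.
set M := map_mx _ _; apply/negP; rewrite -det_tr => /det0P[v v0 vM].
have: pencil_eigenvalue Ar Er z.
  exists v^T; first by rewrite trmx_eq0.
  have /(congr1 trmx) := vM; rewrite trmx_mul trmxK trmx0 => MV.
  have ME : M = z *: Er - Ar.
    apply/matrixP => i j; rewrite /M /descriptor_pencil !mxE rmorphB rmorphM /=.
    by rewrite /horner_eval hornerX !hornerC.
  by move: MV; rewrite ME mulmxBl -scalemxAl => /eqP; rewrite subr_eq0 => /eqP.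
by move/stable; rewrite normcE_norm -[1]/(1%:C) ltcR ltNge z1.
Qed.

End TransferPolynomials.

(** * From the error convolution to the supremum bound *)

Section MainEstimate.
Variable R : realType.
Local Notation C := R[i].

Lemma l2_norm_partial_sums (u : int -> C) : l2_input u ->
  let L := (\sum_(1 <= k <oo) (normc (u k%:Z) ^+ 2)%:E)%E in
  L \is a fin_num /\
  forall n, ((\sum_(i < n) normc (u i%:Z) ^+ 2)%R%:E <= L)%E.
Proof.
move=> [u0 uoo] L.
have t0 i : (0 <= (normc (u i%:Z) ^+ 2)%:E)%E by rewrite lee_fin sqr_ge0.
have L0 : (0 <= L)%E by apply: nneseries_ge0 => i _ _; exact: t0.
split.
  by rewrite ge0_fin_numE//; apply: lty_poweRy uoo; rewrite invr_eq0.
move=> [|n]; first by rewrite big_ord0.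
(* The norm sums from time 1; the extra term at time 0 is zero. *)
rewrite -(big_mkord xpredT (fun i => normc (u i%:Z) ^+ 2)) big_ltn//.
rewrite u0// normc0 expr0n /= add0r -sumEFin.
exact: (@nneseries_lim_ge _ (fun i => (normc (u i%:Z) ^+ 2)%:E)).
Qed.

Lemma linf_norm_convolution (h : nat -> C) (S : R) (m : \bar R) (u e : int -> C) :
  (forall n, \sum_(i < n) normc (h i) <= S) ->
  (forall n, ((\sum_(i < n) normc (h i) ^+ 2)%R%:E <= m)%E) ->
  l2_input u ->
  (forall k : nat, (0 < k)%N ->
    e k%:Z = \sum_(i < k.+1) h i * u ((k - i)%N%:Z)) ->
  (exists2 k : int, 0 < k & linf_norm e = (normc (e k))%:E) /\
  (linf_norm e <= m `^ 2^-1 * l2_norm u)%E.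
Proof.
move=> hS hm ul2 eE; have [] := l2_norm_partial_sums ul2.
rewrite /l2_norm; set L := (\sum_(1 <= _ <oo) _)%E => Lfin uL.
have uV n : \sum_(i < n) normc (u i%:Z) ^+ 2 <= fine L.
  by rewrite -lee_fin fineK// uL.
have L0 : (0 <= L)%E by have := uL 0%N; rewrite big_ord0.
have m0 : (0 <= m)%E by have := hm 0%N; rewrite big_ord0.
have e_small d : 0 < d -> exists k0, forall k : nat, (0 < k)%N -> (k0 <= k)%N ->
    normc (e k%:Z) <= d.
  move=> /(@convolution_to_0 _ h (fun i => u i%:Z) _ _ hS uV)[k0 k0e].
  exists k0 => k k_gt0 k0k.
  by rewrite eE// k0e.
have [K K0 eK] : exists2 K : nat, (0 < K)%N &
    forall k : nat, (0 < k)%N -> normc (e k%:Z) <= normc (e K%:Z).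
  (* If some error is nonzero, the errors eventually fall below it, and a maximum over finitely many
     times is a global one. *)
  have [all0|] := pselect (forall k : nat, (0 < k)%N -> normc (e k%:Z) <= 0).
    by exists 1%N => // k k0; rewrite (le_trans (all0 k k0))// normc_ge0.
  move=> /existsNP[k1] /not_implyP[k1_gt0 /negP]; rewrite -ltNge => ek1.
  have [k0 k0e] := e_small _ ek1.
  have k1n : (k1 < (maxn k0 k1).+1)%N by rewrite ltnS leq_maxr.
  case: (@arg_maxP _ _ _ (Ordinal k1n) (fun i : 'I_(maxn k0 k1).+1 => (0 < i)%N)
    (fun i => normc (e i%:Z)) k1_gt0) => K K0 Kmax.
  exists K => // k k_gt0; have [kn|nk] := ltnP k (maxn k0 k1).+1.
    exact: (Kmax (Ordinal kn)).
  apply: le_trans (Kmax (Ordinal k1n) k1_gt0); apply: k0e => //.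
  by rewrite (leq_trans (leq_maxl _ _) (ltnW nk)).
have linfE : linf_norm e = (normc (e K%:Z))%:E.
  apply/le_anti/andP; split; last by apply: ereal_sup_ubound; exists K%:Z.
  by apply: ge_ereal_sup => _ [[j|j] j_gt0 <-] //; rewrite lee_fin eK.
split; first by exists K%:Z.
rewrite linfE -poweRM//.
have -> : (normc (e K%:Z))%:E = ((normc (e K%:Z) ^+ 2)%:E `^ 2^-1)%E.
  by rewrite poweR_EFin powR12_sqrt ?sqr_ge0// sqrtr_sqr ger0_norm// normc_ge0.
apply: gt0_ler_poweR; rewrite ?invr_ge0// ?in_itv /= ?leey ?andbT ?lee_fin ?sqr_ge0//.
  exact: mule_ge0.
rewrite eE// (le_trans (y := ((\sum_(i < K.+1) normc (h i) ^+ 2)%R%:E *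
    (\sum_(i < K.+1) normc (u i%:Z) ^+ 2)%R%:E)%E))//.
  by rewrite -EFinM lee_fin (convolution_le h (fun i => u i%:Z)).
by apply: lee_pmul; rewrite ?lee_fin ?sumr_ge0// => i _; exact: sqr_ge0.
Qed.

Section DelayTransfer.
Variables (phi : C -> C) (p q : {poly C}) (n : nat) (A : 'M[C]_n) (b c : 'cV[C]_n).
Hypothesis phi_pq : forall z, unit_disk R z -> q.[z] != 0 /\ phi z = p.[z] / q.[z].

Let delay_pencil_horner z : unit_disk R z ->
  map_mx (horner_eval z) (delay_pencil p q A) = q.[z] *: ((phi z)%:M - A).
Proof.
move=> /phi_pq[qz ->]; apply/matrixP => i j.
rewrite /delay_pencil !mxE rmorphB rmorphM rmorphMn /= /horner_eval hornerC.
by rewrite mulrBr mulrnAr mulrCA mulfV ?mulr1.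
Qed.

(** On the disk the determinant is [q^n] times the characteristic polynomial of [A] at [phi z]. If
    it vanished identically, the images of [n + 1] points under the injective [phi] would be too
    many roots. *)
Lemma delay_pencil_det_neq0 :
  {in unit_disk R &, injective phi} -> \det (delay_pencil p q A) != 0.
Proof.
move=> phi_inj; apply/eqP => D0.
(* The shift by 2 keeps every point strictly inside the disk. *)
pose z (k : 'I_n.+1) : C := (k.+2%:R^-1)%:C.
have zD k : unit_disk R (z k).
  by apply/unit_diskE; rewrite normc_real ger0_norm ?invr_ge0// invf_lt1 ?ltr1n.
have z_inj : injective z.
  by move=> i j /complexI/invr_inj/eqP; rewrite eqr_nat => /eqP[]/val_inj.
pose s := [seq phi (z k) | k <- enum 'I_n.+1].
have uniq_s : uniq s.
  rewrite map_inj_uniq ?enum_uniq// => i j /phi_inj ij; apply: z_inj; apply: ij;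
  by rewrite inE; exact: zD.
have root_s : all (root (char_poly A)) s.
  apply/allP => _ /mapP[k _ ->]; apply/eqP.
  have charE w : (char_poly A).[w] = \det (w%:M - A).
    rewrite -/(horner_eval w _) -det_map_mx; congr (\det _).
    apply/matrixP => i j; rewrite !mxE rmorphB rmorphMn /= /horner_eval.
    by rewrite hornerX hornerC.
  have : horner_eval (z k) (\det (delay_pencil p q A)) = 0.
    by rewrite D0 /horner_eval horner0.
  rewrite -det_map_mx delay_pencil_horner// detZ => /eqP.
  by rewrite mulf_eq0 expf_eq0 (negbTE (phi_pq (zD k)).1) andbF -charE => /eqP.
have := max_poly_roots (monic_neq0 (char_poly_monic A)) root_s uniq_s.
by rewrite size_map size_enum_ord size_char_poly ltnn.
Qed.

Lemma delay_transfer_horner z : unit_disk R z ->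
  (\det (delay_pencil p q A)).[z] != 0 ->
  (phi z)%:M - A \in unitmx /\
  (\det (delay_pencil p q A)).[z] * resolvent_form c ((phi z)%:M - A) b =
  (transfer_num (delay_pencil p q A) (q *: map_mx polyC b) (c ^t*)).[z].
Proof.
move=> zD Dz.
have uA : (phi z)%:M - A \in unitmx.
  rewrite unitmxE unitfE; apply: contraNneq Dz => dA.
  rewrite -/(horner_eval z _) -det_map_mx delay_pencil_horner// detZ dA mulr0//.
split=> //; rewrite /resolvent_form -mulmxA; apply: transfer_horner.
rewrite delay_pencil_horner// -scalemxAl mulmxA mulmxV// mul1mx.
by apply/matrixP => i j; rewrite !mxE rmorphM /= /horner_eval hornerC.
Qed.

End DelayTransfer.

Lemma descriptor_transfer_horner r (Er Ar : 'M[C]_r) (br cr : 'cV[C]_r) z :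
  (\det (descriptor_pencil Er Ar)).[z] != 0 ->
  (\det (descriptor_pencil Er Ar)).[z] * resolvent_form cr (z *: Er - Ar) br =
  (transfer_num (descriptor_pencil Er Ar) (map_mx polyC br) (cr ^t*)).[z].
Proof.
have ME : map_mx (horner_eval z) (descriptor_pencil Er Ar) = z *: Er - Ar.
  apply/matrixP => i j; rewrite /descriptor_pencil !mxE rmorphB rmorphM /=.
  by rewrite /horner_eval hornerX !hornerC.
move=> Dz; rewrite /resolvent_form -mulmxA; apply: transfer_horner.
have uM : z *: Er - Ar \in unitmx by rewrite unitmxE unitfE -ME det_map_mx.
rewrite ME mulmxA mulmxV// mul1mx.
by apply/matrixP => i j; rewrite !mxE /= /horner_eval hornerC.
Qed.

End MainEstimate.

Theorem mainTheorem3 (R : realType) (AA : set R[i]) (phi psi : R[i] -> R[i])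
  (np nq : nat) (p q : {poly R[i]})
  (n : nat) (A : 'M[R[i]]_n) (b c : 'cV[R[i]]_n) (G : R[i] -> R[i])
  (r : nat) (Er Ar : 'M[R[i]]_r) (br cr : 'cV[R[i]]_r) (dr : R[i])
  (Gr : R[i] -> R[i])
  (u : int -> R[i]) (x : int -> 'cV[R[i]]_n) (y : int -> R[i])
  (xr : int -> 'cV[R[i]]_r) (yr : int -> R[i])
  (AA_domain : simply_connected_domain AA)
  (phi_conformal : conformal_on (unit_disk R) phi)
  (phi_bij : set_bij (unit_disk R) AA phi)
  (phi_inv : forall z, unit_disk R z -> psi (phi z) = z)
  (np_ge1 : (1 <= np)%N) (nq_ge1 : (1 <= nq)%N)
  (p_order : size p = np.+1) (q_order : size q = nq.+1)
  (phi_pq : forall z, unit_disk R z -> q.[z] != 0 /\ phi z = p.[z] / q.[z])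
  (G_def : forall s, AA s -> s%:M - A \in unitmx ->
     G s = resolvent_form c (s%:M - A) b)
  (G_H2 : in_H2_via phi AA G)
  (pencil_stable : forall lam, pencil_eigenvalue Ar Er lam -> 1 < `|lam|)
  (Gr_def : forall s, AA s ->
     Gr s = resolvent_form cr (psi s *: Er - Ar) br + dr)
  (Gr_H2 : in_H2_via phi AA Gr)
  (u_l2 : l2_input u)
  (full_output : delay_system np nq p q A b c u x y)
  (reduced_output : reduced_system Er Ar br cr dr u xr yr) :
  let err := fun k => y k - yr k in
  (exists2 k : int, 0 < k & linf_norm err = (normc (err k))%:E) /\
  (linf_norm err <= H2_norm_via phi (fun s => G s - Gr s)%R * l2_norm u)%E.
Proof.
move=> err.
have phiA z : unit_disk R z -> AA (phi z).
  by move=> zD; case: phi_bij => fun_phi _ _; exact: fun_phi.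
have phi_injective : {in unit_disk R &, injective phi}.
  by move=> z w; rewrite !inE => zD wD /(congr1 psi); rewrite !phi_inv.
have u0 := u_l2.1.
pose M := delay_pencil p q A; pose D := \det M.
pose N := transfer_num M (q *: map_mx polyC b) (c ^t*).
pose M2 := descriptor_pencil Er Ar; pose D2 := \det M2.
pose N2 := transfer_num M2 (map_mx polyC br) (cr ^t*) + dr%:P * D2.
have D0 : D != 0 := delay_pencil_det_neq0 A phi_pq phi_injective.
have D2z : forall z, normc z <= 1 -> D2.[z] != 0 := descriptor_pencil_det_neq0 pencil_stable.
have GE z : normc z < 1 -> D.[z] != 0 -> D.[z] * (G \o phi) z = N.[z].
  move=> /unit_diskE zD Dz.
  have [uA <-] := delay_transfer_horner b c phi_pq zD Dz.
  by rewrite /= G_def//; exact: phiA.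
have GrE z : normc z < 1 -> (Gr \o phi) z = N2.[z] / D2.[z].
  move=> z1; have zD : unit_disk R z by apply/unit_diskE.
  have Dz := D2z z (ltW z1).
  rewrite /= Gr_def ?phi_inv//; last exact: phiA.
  rewrite /N2 hornerD hornerM hornerC -descriptor_transfer_horner//.
  by rewrite mulrDl mulfK// mulrAC mulfV// mul1r.
(* [D2] has no zero in the closed disk, but [D] may have some; membership of [G \o phi] in the Hardy
   space makes them cancel. *)
have [D1 [N1 [DN1 D1z GE1]]] := H2_rational G_H2.2 D0 GE.
pose D3 := D1 * D2; pose N3 := N1 * D2 - N2 * D1.
have D3z z : normc z <= 1 -> D3.[z] != 0.
  by move=> z1; rewrite hornerM mulf_neq0 ?D1z ?D2z.
have D3_neq0 : D3 != 0.
  apply: contraTneq (D3z 0 _) => [->|]; first by rewrite horner0 eqxx.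
  by rewrite normc0.
have D3_root z : root D3 z -> 1 < normc z.
  by move=> Dz; rewrite ltNge; apply/negP => /D3z; rewrite (eqP Dz) eqxx.
have errE z : normc z < 1 -> ((fun s => G s - Gr s) \o phi) z = N3.[z] / D3.[z].
  move=> z1; have -> : ((fun s => G s - Gr s) \o phi) z = (G \o phi) z - (Gr \o phi) z by [].
  rewrite GE1// GrE// /N3 /D3 [(_ - _).[z]]hornerD hornerN !hornerM.
  by field; rewrite D1z ?D2z ?ltW.
have [h hE] : exists h : nat -> R[i], forall n, 'X^n %| D3 * \poly_(i < n) h i - N3.
  by apply: exists_quotient_series; rewrite D3z// normc0.
have [S hS] := quotient_series_summable D3_neq0 D3_root hE.
have hB k := quotient_series_Bessel k D3_neq0 D3z hE.
have normE : H2_norm_via phi (fun s => G s - Gr s) =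
    (circle_mean (fun t => N3.[expi t] / D3.[expi t])%R `^ 2^-1)%E.
  rewrite /H2_norm_via /H2_norm; congr (circle_mean _ `^ _)%E.
  by apply/funext => t; exact: boundary_value_quotient.
rewrite normE; apply: (linf_norm_convolution hS hB u_l2) => k k_gt0.
(* The output equations fix [y] and [yr] only at positive times; these formulas also give the
   coefficient at time 0. *)
pose Y k := (c ^t* *m x k) 0 0; pose Yr k := (cr ^t* *m xr k) 0 0 + dr * u k.
have dY K : 'X^K %| D * series_poly Y K - N * series_poly u K.
  apply: transfer_series => l.
  exact: (delay_system_pencil _ _ p_order q_order u0 full_output).
have dYr K : 'X^K %| D2 * series_poly Yr K - N2 * series_poly u K.
  have -> : series_poly Yr K =
      series_poly (fun k => (cr ^t* *m xr k) 0 0) K + dr%:P * series_poly u K.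
    apply/polyP => i; rewrite coefD coefCM !coef_poly.
    by case: ifP; rewrite // mulr0 addr0.
  rewrite /N2 mulrDr mulrDl mulrCA mulrA opprD addrACA subrr addr0.
  apply: transfer_series => l.
  exact: (reduced_system_pencil _ _ u0 reduced_output).
(* Cancelling [D * D3] loses at most [size (D * D3)] orders, so coefficients up to [k] survive. *)
pose K := (size (D * D3)%R + k.+1)%N.
pose E := series_poly Y K - series_poly Yr K - \poly_(i < K) h i * series_poly u K.
have : 'X^(k.+1) %| E.
  apply: (@dvdp_Xn_cancel _ (D * D3)); first by rewrite mulf_neq0.
  (* The first three brackets are divisible by ['X^K]: the two recurrences and the series of the
     error function. The last vanishes because [N1 / D1] is the reduced form of [N / D]. *)
  have -> : D * D3 * E = D1 * D2 * (D * series_poly Y K - N * series_poly u K)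
      - D * D1 * (D2 * series_poly Yr K - N2 * series_poly u K)
      - D * series_poly u K * (D3 * \poly_(i < K) h i - N3)
      - (D * N1 - N * D1) * D2 * series_poly u K.
    by rewrite /E /D3 /N3; ring.
  by rewrite DN1 subrr !mul0r subr0 !dvdp_sub ?dvdp_mull ?dY ?dYr ?hE.
move=> /dvdp_XnP/(_ k (leqnn _)).
have kK : (k < K)%N by rewrite /K addnS ltnS leq_addl.
rewrite /E !coefB !coef_poly kK => /eqP; rewrite subr_eq0 => /eqP YE.
have [_ _ yE] := full_output; have [_ _ yrE] := reduced_output.
rewrite /err yE// yrE// [LHS]YE coefM; apply: eq_bigr => i _.
by rewrite !coef_poly (leq_ltn_trans (leq_subr _ _) kK) (leq_ltn_trans _ kK)// -ltnS.
Qed.
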